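(* Let $h^*(t)=\alpha+\beta t$ be the unique real polynomial of degree at most $1$ minimizing $\max_{t\in[0,1]}\left|\frac{h(t)}{\sqrt{1+t^2}}-1\right|$ among all real polynomials $h$ of degree at most $1$. Then the coefficient $\alpha$ is a root of the polynomial $$P_1(x)=x^4+24x^3-8x^2-32x+16\in\mathbb{Q}[x],$$ which is irreducible over $\mathbb{Q}$, has Galois group over $\mathbb{Q}$ isomorphic to $C_4$ (cyclic of order $4$), and has discriminant $2^{29}$; and $$\alpha=\frac{2\cos(\pi/8)}{1+\cos(\pi/8)}=\frac{2}{1+\sqrt{4-2\sqrt2}}\approx 0.9604.$$ *)

(* Defs.v *)
From HB Require Import structures.
From mathcomp Require Import all_boot all_order all_algebra all_fingroup all_field.
From mathcomp Require Import classical_sets reals trigo.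

Set Implicit Arguments.
Unset Strict Implicit.
Unset Printing Implicit Defensive.

Import Order.TTheory GRing.Theory Num.Theory.

Local Open Scope classical_set_scope.
Local Open Scope ring_scope.

(* The error function is continuous on the compact interval [0, 1], so this
   supremum is a maximum. *)
Definition max_rel_err (R : realType) (h : {poly R}) : R :=
  sup [set `|h.[t] / Num.sqrt (1 + t ^+ 2) - 1| | t in [set t | 0 <= t <= 1]].

Definition is_best_affine (R : realType) (h : {poly R}) : Prop :=
  (size h <= 2)%N /\
  forall g : {poly R}, (size g <= 2)%N -> max_rel_err h <= max_rel_err g.

Definition P1 : {poly rat} :=
  'X^4 + 24 *: 'X^3 - 8 *: 'X^2 - 32 *: 'X + 16%:P.

(* disc p = (-1)^(n(n-1)/2) Res(p, p') / lc(p) with n = deg p.  The rows and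
   columns of Sylvester_mx are in increasing order of degree, which changes the
   usual Res(p, q) by (-1)^(deg p * deg q); as n(n-1) is even, the value is the
   usual one here.  Characteristic 0 ensures deg p' = n - 1. *)
Definition discriminant (F : numFieldType) (p : {poly F}) : F :=
  (-1) ^+ 'C((size p).-1, 2) * resultant p p^`() / lead_coef p.

(* The existence clause keeps the quantification over all splitting fields L of
   p from being vacuous. *)
Definition galois_group_isog (p : {poly rat}) (gT : finGroupType)
    (G : {group gT}) : Prop :=
  let is_splitting_field (L : splittingFieldType rat) :=
    splittingFieldFor 1%AS (map_poly (in_alg L) p) {:L}%AS in
  (exists L, is_splitting_field L) /\
  (forall L, is_splitting_field L -> 'Gal({:L} / 1) \isog G).

(* Main.v *)
(* Writing t = tan theta turns h(t) / sqrt(1+t^2) into a sinusoid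
   r cos(theta - phi) on [0, pi/4]; the best one has its crest at the midpoint
   pi/8 and misses 1 by the same amount err = (1-c)/(1+c), c = cos(pi/8), at
   theta = 0, pi/8, pi/4 with alternating signs.  Optimality and uniqueness both
   come from these three points: the value at pi/8 is a positive combination of
   the values at 0 and pi/4, so no affine h does better there.
   With u = 2 cos(pi/8) one has alpha = 2u/(2+u), hence P1 is a Moebius
   transform of the minimal polynomial X^4 - 4X^2 + 2 of u, which is Eisenstein
   at 2.  The map u -> u^3 - 3u (cos theta -> cos 3theta) permutes its roots
   cyclically with square u -> -u, so the Galois group is cyclic of order 4. *)
Require Import Defs.
From HB Require Import structures.
From mathcomp Require Import all_boot all_order all_algebra all_fingroup all_field.
From mathcomp Require Import classical_sets reals trigo.
From mathcomp Require Import cyclic ring lra ssrZ.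

Set Implicit Arguments.
Unset Strict Implicit.
Unset Printing Implicit Defensive.

Import Order.TTheory GRing.Theory Num.Theory.

Local Open Scope ring_scope.

(** * Discriminant *)

(* Unlike \det, whose bigops are locked, this reduces by computation; the
   coefficients are moved to Z because int and rat are unary. *)
Fixpoint laplace_det (R : nzRingType) (n : nat) (A : nat -> nat -> R) : R :=
  if n is m.+1 then
    foldr (fun j s => if A 0 j == 0 then s else
      A 0 j * ((-1) ^+ j * laplace_det m (fun i k => A i.+1 (bump j k))) + s)
      0 (iota 0 n)
  else 1.

Lemma det_laplace_det (R : comNzRingType) n (M : 'M[R]_n)
    (A : nat -> nat -> R) :
  (forall i j, M i j = A i j) -> \det M = laplace_det n A.
Proof.
elim: n => [|n IHn] in M A * => eqMA; first by rewrite det_mx00.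
rewrite (expand_det_row _ ord0).
have -> : \sum_j M ord0 j * cofactor M ord0 j =
    \sum_(0 <= j < n.+1) A 0 j * ((-1) ^+ j *
      laplace_det n (fun i k => A i.+1 (bump j k))).
  rewrite big_mkord; apply: eq_bigr => j _.
  rewrite eqMA /cofactor add0n; congr (_ * (_ * _)); apply: IHn => i k.
  by rewrite !mxE eqMA.
rewrite unlock /laplace_det -/laplace_det /index_iota subn0.
elim: (iota 0 n.+1) => //= j s ->.
by case: eqP => [->|//]; rewrite mul0r add0r.
Qed.

(** Injectivity of [f] makes the zero tests of the two expansions agree. *)
Lemma rmorph_laplace_det (R S : nzRingType) (f : {rmorphism R -> S}) n A B :
  injective f -> (forall i j, B i j = f (A i j)) ->
  laplace_det n B = f (laplace_det n A).
Proof.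
move=> injf; elim: n => [|n IHn] in A B * => eqBA; first by rewrite rmorph1.
rewrite /laplace_det -/laplace_det.
elim: (iota 0 n.+1) => [|j s IHs] /=; first by rewrite rmorph0.
rewrite eqBA raddf_eq0 // IHs; case: ifP => // _.
rewrite rmorphD !rmorphM rmorph_sign.
by rewrite (IHn (fun i k => A i.+1 (bump j k))).
Qed.

(** Natural subtraction truncates, so the multiplicity [*+ (i <= j)] is what puts zeros to the left
    of each shifted row. *)
Definition sylvester (R : nzRingType) (s t : seq R) (i j : nat) : R :=
  let n := (size t).-1 in
  if (i < n)%N then s`_(j - i) *+ (i <= j)
  else t`_(j - (i - n)) *+ (i - n <= j).

Lemma resultant_laplace_det (R : comNzRingType) (p q : {poly R}) :
  resultant p q = laplace_det ((size q).-1 + (size p).-1) (sylvester p q).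
Proof.
apply: det_laplace_det => i j; rewrite Sylvester_mxE /sylvester.
by case: splitP => k ->; rewrite ?addKn.
Qed.

Definition rat_of_Z : {rmorphism BinNums.Z -> rat} := intr \o int_of_Z.

Lemma rat_of_Z_inj : injective rat_of_Z.
Proof. by move=> x y /= /intr_inj; apply: (can_inj int_of_ZK). Qed.

Lemma rmorph_resultant_Z (s t : seq BinNums.Z) (p q : {poly rat}) :
  p = map rat_of_Z s :> seq rat -> q = map rat_of_Z t :> seq rat ->
  resultant p q =
  rat_of_Z (laplace_det ((size t).-1 + (size s).-1) (sylvester s t)).
Proof.
move=> ps qt; rewrite resultant_laplace_det ps qt !size_map.
apply: rmorph_laplace_det rat_of_Z_inj _ => i j.
rewrite /sylvester size_map.
have nthf u k : (map rat_of_Z u)`_k = rat_of_Z u`_k.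
  by rewrite -(rmorph0 rat_of_Z); elim: u k => [|a u IHu] [|k] //=.
by rewrite !nthf -!rmorphMn; case: ifP.
Qed.

Lemma P1_seq : P1 = map rat_of_Z [:: 16; -32; -8; 24; 1] :> seq rat.
Proof.
have <- := @PolyK _ 0 (map rat_of_Z [:: 16; -32; -8; 24; 1]) isT.
congr polyseq; apply/polyP=> i; rewrite /P1 !(coefE, coef_Poly).
by do 5?[case: i => [|i]//=]; rewrite nth_nil; ring.
Qed.

Lemma deriv_P1_seq : P1^`() = map rat_of_Z [:: -32; -16; 72; 4] :> seq rat.
Proof.
have <- := @PolyK _ 0 (map rat_of_Z [:: -32; -16; 72; 4]) isT.
congr polyseq; apply/polyP=> i; rewrite coef_deriv P1_seq coef_Poly.
by do 5?[case: i => [|i]//=]; rewrite ?nth_nil ?mul0rn.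
Qed.

Lemma discriminant_P1 : discriminant P1 = 2 ^+ 29.
Proof.
rewrite /discriminant lead_coefE (rmorph_resultant_Z P1_seq deriv_P1_seq).
set d := laplace_det _ _.
have -> : d = 2 ^+ 29 by vm_compute.
(* The sign is (-1)^6 = 1, as 'C(4, 2) = 6. *)
by rewrite P1_seq -[nth _ _ _]/(1 : rat) divr1 mul1r rmorphXn rmorph_nat.
Qed.

(** * Irreducibility and Galois group *)

(* The minimal polynomial of 2 cos(pi/8). *)
Definition quarticQ (R : nzRingType) : {poly R} := 'X^4 - 4 *: 'X^2 + 2%:P.

Lemma size_quarticQ (R : nzRingType) : size (quarticQ R) = 5%N.
Proof.
rewrite /quarticQ -addrA size_polyDl size_polyXn // ltnS.
rewrite (leq_trans (size_polyD _ _)) // geq_max size_polyN.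
rewrite (leq_trans (size_scale_leq _ _)) ?size_polyXn //.
exact: leq_trans (size_polyC_leq1 _) _.
Qed.

Lemma horner_quarticQ (R : comNzRingType) (x : R) :
  (quarticQ R).[x] = x ^+ 4 - 4 * x ^+ 2 + 2.
Proof. by rewrite /quarticQ !hornerE. Qed.

Lemma map_quarticQ (R S : nzRingType) (f : {rmorphism R -> S}) :
  map_poly f (quarticQ R) = quarticQ S.
Proof.
rewrite /quarticQ rmorphD rmorphB /= map_polyZ !map_polyXn map_polyC /=.
by rewrite !rmorph_nat.
Qed.

Lemma irreducible_quarticQ : irreducible_poly (quarticQ rat).
Proof.
rewrite -(map_quarticQ intr); apply/irreducible_rat_int.
have sizeQ := size_quarticQ int.
apply: (@eisenstein_crit 2); rewrite ?lead_coefE ?sizeQ //.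
- by rewrite /quarticQ !coefE.
- by rewrite /quarticQ !coefE.
- by move=> [|[|[|[|i]]]]; rewrite /quarticQ ?coefE.
Qed.

Lemma horner_P1 (F : fieldType) (f : {rmorphism rat -> F}) (x : F) :
  (map_poly f P1).[x] = x ^+ 4 + 24 * x ^+ 3 - 8 * x ^+ 2 - 32 * x + 16.
Proof.
rewrite /P1 rmorphD 2!rmorphB rmorphD /= !map_polyZ !map_polyXn map_polyX.
rewrite map_polyC !rmorph_nat.
rewrite !(hornerD, hornerN, hornerZ, hornerXn, hornerX, hornerC).
by congr (_ + _); apply: rmorph_nat.
Qed.

(** * Minimal polynomials and irreducibility *)

Section Fields.
Variables (F : fieldType) (L : fieldExtType F).

(** The minimal polynomial has coefficients in [F], so its divisibility relation to [p] descends
    from [L] to [F]. *)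
Lemma minPoly_irreducible (p : {poly F}) (x : L) :
  irreducible_poly p -> root (map_poly (in_alg L) p) x ->
  minPoly 1 x %= map_poly (in_alg L) p.
Proof.
move=> [_ irr_p] px0.
have /polyOver1P[m Dm] := minPolyOver 1%AS x.
have : minPoly 1 x %| map_poly (in_alg L) p.
  by apply: minPoly_dvdp => //; apply: alg_polyOver.
rewrite Dm dvdp_map eqp_map => /irr_p; apply.
by rewrite -(size_map_poly (in_alg L)) -Dm size_minPoly.
Qed.

(** By degree, [p] is associate to the minimal polynomial of [x]. This serves for [P1], where
    Eisenstein at 2 fails because 4 divides the constant term. *)
Lemma irreducible_poly_minPoly (p : {poly F}) (x : L) :
  root (map_poly (in_alg L) p) x -> size p = (adjoin_degree 1 x).+1 ->
  irreducible_poly p.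
Proof.
move=> px0 size_p.
have eq_p : minPoly 1 x %= map_poly (in_alg L) p.
  rewrite -dvdp_size_eqp ?minPoly_dvdp ?alg_polyOver //.
  by rewrite size_map_poly size_p size_minPoly.
split=> [|q size_q]; first by rewrite size_p ltnS.
rewrite -(dvdp_map (in_alg L)) -(eqp_dvdr _ eq_p) => /minPoly_irr-/(_ _)/orP[].
- exact: alg_polyOver.
- by move=> Eq; rewrite -(eqp_map (in_alg L)) (eqp_trans Eq).
- rewrite -size_poly_eq1 size_map_poly => sq1; by rewrite sq1 in size_q.
Qed.
End Fields.

(** * The Moebius substitution and the roots of the quartic *)

Section Moebius.
Variable F : fieldType.
Implicit Types x y u w : F.

(* Maps 2 cos(pi/8) to alpha. *)
Definition moebius u : F := 2 * u / (2 + u).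

(* 2 cos(theta) |-> 2 cos(3 theta). *)
Definition quarticQ_conj u : F := u ^+ 3 - 3 * u.

Hypothesis two_neq0 : 2 != 0 :> F.

Let fourneq0 : 4 != 0 :> F.
Proof. by rewrite (_ : 4 = 2 * 2 :> F) ?mulf_neq0 //; ring. Qed.

Lemma root_quarticQ_neqN2 u : root (quarticQ F) u -> 2 + u != 0.
Proof.
rewrite /root horner_quarticQ; apply: contraTneq => u2.
have -> : u = - 2 by apply/eqP; rewrite -addr_eq0 addrC u2.
by rewrite (_ : _ - _ + _ = 2 :> F) //; ring.
Qed.

Lemma horner_P1_moebius u : 2 + u != 0 ->
  let x := moebius u in
  x ^+ 4 + 24 * x ^+ 3 - 8 * x ^+ 2 - 32 * x + 16 =
  128 * (quarticQ F).[u] / (2 + u) ^+ 4.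
Proof. by move=> u2 /=; rewrite horner_quarticQ /moebius; field. Qed.

Lemma moebius_inj u w : 2 + u != 0 -> 2 + w != 0 ->
  moebius u = moebius w -> u = w.
Proof.
move=> u2 w2 /eqP; rewrite eqr_div // => /eqP E.
have : 4 * (u - w) = 2 * u * (2 + w) - 2 * w * (2 + u) by ring.
by rewrite E subrr => /eqP; rewrite mulf_eq0 (negPf fourneq0) subr_eq0 => /eqP.
Qed.

(** The inverse map x |-> 2x / (2 - x) is defined at every root, since the quartic takes the value
    2^7 at 2. *)
Lemma P1_root_moebius x : x ^+ 4 + 24 * x ^+ 3 - 8 * x ^+ 2 - 32 * x + 16 = 0 ->
  exists2 u, root (quarticQ F) u & x = moebius u.
Proof.
move=> Px0.
have x2 : 2 - x != 0.
  apply/eqP=> /subr0_eq Ex; move/eqP: Px0; rewrite -Ex.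
  by rewrite (_ : _ + _ = 2 ^+ 7 :> F) ?expf_eq0 ?(negPf two_neq0) //; ring.
have Eu : 2 + 2 * x / (2 - x) = 4 / (2 - x) by field.
exists (2 * x / (2 - x)); last by rewrite /moebius Eu; field; rewrite x2 fourneq0.
rewrite /root horner_quarticQ.
rewrite (_ : _ + 2 =
  2 * (x ^+ 4 + 24 * x ^+ 3 - 8 * x ^+ 2 - 32 * x + 16) / (2 - x) ^+ 4).
  by rewrite Px0 mulr0 mul0r.
by field.
Qed.

Lemma root_quarticQ_conj u :
  root (quarticQ F) u -> root (quarticQ F) (quarticQ_conj u).
Proof.
rewrite /root !horner_quarticQ /quarticQ_conj => /eqP Q0; apply/eqP.
(* With C_n(2 cos x) = 2 cos(n x), the left-hand side is
   C_4 \o C_3 = C_3 \o C_4 at u, where C_4 = quarticQ and C_3 = X^3 - 3X. *)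
set q := u ^+ 4 - 4 * u ^+ 2 + 2 in Q0.
rewrite -[RHS](mulr0 (q ^+ 2 - 3)) -[in RHS]Q0 /q.
by ring.
Qed.

Lemma quarticQ_conjK u : root (quarticQ F) u ->
  quarticQ_conj (quarticQ_conj u) = - u.
Proof.
rewrite /root horner_quarticQ /quarticQ_conj => /eqP Q0; apply/eqP.
(* C_9 + C_1 = C_5 * C_4. *)
rewrite -subr_eq0 -(mulr0 (u ^+ 5 - 5 * u ^+ 3 + 5 * u)) -Q0.
by apply/eqP; ring.
Qed.

(** With u = 2 cos x and cos 4x = 0, cos 3x is sin x up to sign. As polynomials, C_6 + C_2 = C_2 *
    C_4. *)
Lemma sqr_quarticQ_conj u :
  root (quarticQ F) u -> quarticQ_conj u ^+ 2 = 4 - u ^+ 2.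
Proof.
rewrite /root horner_quarticQ => /eqP Q0.
apply/eqP; rewrite -subr_eq0 -(mulr0 (u ^+ 2 - 2)) -Q0; apply/eqP.
by rewrite /quarticQ_conj; ring.
Qed.

Definition quarticQ_roots u := [:: u; quarticQ_conj u; - u; - quarticQ_conj u].

(** The squares of [u] and of its conjugate have sum 4 and product 2, so they are the two roots of
    Y^2 - 4Y + 2, and Y = X^2. *)
Lemma quarticQ_factor u : root (quarticQ F) u ->
  quarticQ F = \prod_(w <- quarticQ_roots u) ('X - w%:P).
Proof.
move=> Qu; have Ev := sqr_quarticQ_conj Qu.
move: Qu; rewrite /root horner_quarticQ => /eqP Q0.
have E2 : u ^+ 2 * quarticQ_conj u ^+ 2 = 2.
  by rewrite Ev; apply/eqP; rewrite -subr_eq0 -oppr_eq0 -Q0; apply/eqP; ring.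
rewrite /quarticQ_roots !big_cons big_nil /quarticQ -mul_polyC -E2.
have -> : 4 = u ^+ 2 + quarticQ_conj u ^+ 2 by rewrite Ev; ring.
rewrite !(polyCD, polyCN, polyCM, polyC_exp).
by set U := u%:P; set V := (quarticQ_conj u)%:P; ring.
Qed.

Lemma uniq_quarticQ_roots u : root (quarticQ F) u -> uniq (quarticQ_roots u).
Proof.
move=> Qu; have Ev := sqr_quarticQ_conj Qu.
have Qv := root_quarticQ_conj Qu.
have neq0 w : root (quarticQ F) w -> w != 0.
  rewrite /root horner_quarticQ; apply: contraTneq => ->.
  by rewrite !expr0n mulr0 subr0 add0r.
have neqN w : root (quarticQ F) w -> (w == - w) = false.
  move/neq0=> w0; apply: negbTE; rewrite -addr_eq0 (_ : w + w = 2 * w); last by ring.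
  by rewrite mulf_neq0.
(* The squares sum to 4, so equality would give u^2 = 2, where the quartic is -2. *)
have sq_neq : u ^+ 2 != quarticQ_conj u ^+ 2.
  rewrite Ev; apply: contraL Qu => /eqP E; rewrite /root horner_quarticQ.
  have E2 : u ^+ 2 = 2.
    by apply: (mulfI two_neq0); rewrite mulr_natl mulr2n {1}E; ring.
  rewrite (_ : _ + _ = (u ^+ 2) ^+ 2 - 4 * u ^+ 2 + 2); last by ring.
  by rewrite E2 (_ : _ + _ = - 2 :> F) ?oppr_eq0 //; ring.
have neq w w' : w ^+ 2 != w' ^+ 2 -> (w == w') = false.
  by move=> ne; apply: contraNF ne => /eqP->.
rewrite /quarticQ_roots; set v := quarticQ_conj u in Qv sq_neq *.
rewrite /= !inE (neqN u Qu) (neqN v Qv) (neq u v) // (neq u (- v)) ?sqrrN //.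
by rewrite (neq v (- u)) ?sqrrN 1?[v ^+ 2 == _]eq_sym // (neq (- u) (- v)) ?sqrrN.
Qed.
End Moebius.

(** * Extensions of Q generated by a root *)

Section Extension.
Variable L : fieldExtType rat.
Implicit Types u x : L.

Lemma two_neq0_ext : 2 != 0 :> L.
Proof. by rewrite -(rmorph_nat (in_alg L)) fmorph_eq0. Qed.
Let two_neq0 := two_neq0_ext.

Lemma root_P1_exists_moebius x : root (map_poly (in_alg L) P1) x ->
  exists2 u, root (quarticQ L) u & x = moebius u.
Proof. by move/rootP; rewrite horner_P1; apply: P1_root_moebius. Qed.

Lemma root_P1_moebius u : root (quarticQ L) u ->
  root (map_poly (in_alg L) P1) (moebius u).
Proof.
move=> Qu; apply/rootP; rewrite horner_P1 horner_P1_moebius.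
  by rewrite (rootP Qu) mulr0 mul0r.
exact: root_quarticQ_neqN2.
Qed.

Lemma mem_quarticQ_conj (K : {subfield L}) u :
  u \in K -> quarticQ_conj u \in K.
Proof. by move=> Ku; rewrite rpredB ?rpredX ?rpredM ?rpred_nat. Qed.

Lemma mem_quarticQ_roots (K : {subfield L}) u :
  u \in K -> {subset quarticQ_roots u <= K}.
Proof.
move=> Ku; have Kv := mem_quarticQ_conj Ku.
by apply/allP; rewrite /= !rpredN Ku Kv.
Qed.

Lemma mem_moebius (K : {subfield L}) u : u \in K -> moebius u \in K.
Proof. by move=> Ku; rewrite rpred_div ?rpredM ?rpredD ?mem1v. Qed.

Lemma mem_moebius_inv (K : {subfield L}) x : x \in K -> 2 * x / (2 - x) \in K.
Proof. by move=> Kx; rewrite rpred_div ?rpredM ?rpredB ?rpredD ?mem1v. Qed.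

Lemma adjoin_moebius u : root (quarticQ L) u ->
  <<1; moebius u>>%VS = <<1; u>>%VS.
Proof.
move=> Qu; have u2 := root_quarticQ_neqN2 two_neq0 Qu.
apply/eqP; rewrite eqEsubv !sub_adjoin1v mem_moebius ?memv_adjoin //=.
set x := moebius u.
have -> : u = 2 * x / (2 - x).
  have -> : 2 - x = 4 / (2 + u) by rewrite /x /moebius; field.
  rewrite /x /moebius; field.
  by rewrite u2 (_ : 4 = 2 * 2 :> L) ?mulf_neq0 //; ring.
exact: mem_moebius_inv (memv_adjoin 1 x).
Qed.

Lemma splittingFieldFor_P1 u : root (quarticQ L) u -> <<1; u>>%VS = {:L}%VS ->
  splittingFieldFor 1%AS (map_poly (in_alg L) P1) {:L}%AS.
Proof.
move=> Qu genL; exists (map (@moebius L) (quarticQ_roots u)); last first.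
  apply/eqP; rewrite eqEsubv subvf /= adjoin_cons adjoin_moebius // genL.
  exact: subv_adjoin_seq.
have Qs w : w \in quarticQ_roots u -> root (quarticQ L) w.
  by rewrite (quarticQ_factor Qu) root_prod_XsubC.
set rs := map _ _; rewrite [X in X %= _](@all_roots_prod_XsubC _ _ rs).
- by rewrite eqp_scale // lead_coef_eq0 map_poly_eq0 -size_poly_eq0 P1_seq.
- by rewrite size_map_poly P1_seq.
- by apply/allP=> _ /mapP[w /Qs Qw ->]; apply: root_P1_moebius.
rewrite uniq_rootsE map_inj_in_uniq ?uniq_quarticQ_roots //.
by move=> w w' /Qs Qw /Qs Qw' /=; apply: moebius_inj; rewrite ?root_quarticQ_neqN2.
Qed.

Lemma adjoin_degree_quarticQ u : root (quarticQ L) u -> adjoin_degree 1 u = 4%N.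
Proof.
rewrite -(map_quarticQ (in_alg L)) => Qu; apply: succn_inj.
rewrite -size_minPoly (eqp_size (minPoly_irreducible irreducible_quarticQ Qu)).
by rewrite size_map_poly size_quarticQ.
Qed.
End Extension.

(** * Irreducibility and Galois group of [P1] *)

Lemma exists_quarticQ_ext : exists (L : fieldExtType rat) (u : L),
  root (quarticQ L) u /\ <<1; u>>%VS = {:L}%VS.
Proof.
have [L _ [u Qu genL]] := irredp_FAdjoin irreducible_quarticQ.
by exists L, u; rewrite -(map_quarticQ (in_alg L)).
Qed.

(** [moebius u] generates the same field as [u], hence has degree 4 over Q. *)
Lemma irreducible_P1 : irreducible_poly P1.
Proof.
have [L [u [Qu genL]]] := exists_quarticQ_ext.
apply: (irreducible_poly_minPoly (root_P1_moebius Qu)).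
rewrite P1_seq adjoin_degreeE adjoin_moebius // -adjoin_degreeE.
by rewrite adjoin_degree_quarticQ.
Qed.

Lemma gal_P1 (L : splittingFieldType rat) :
  splittingFieldFor 1%AS (map_poly (in_alg L) P1) {:L}%AS ->
  'Gal({:L} / 1) \isog Zp_group 4.
Proof.
case=> rs Drs genL.
have rootsP x : root (map_poly (in_alg L) P1) x = (x \in rs).
  by rewrite (eqp_root Drs) root_prod_XsubC.
(* Pull one root of [P1] back to [u]: all roots of the quartic are polynomials in [u], so every root
   of [P1] lies in Q(u). *)
have [u Qu genu] : exists2 u, root (quarticQ L) u & <<1; u>>%VS = {:L}%VS.
  have sz_rs : size rs = 4%N.
    apply: succn_inj; rewrite -(size_prod_XsubC rs id) -(eqp_size Drs).
    by rewrite size_map_poly P1_seq.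
  have [|u Qu _] := @root_P1_exists_moebius L rs`_0; first by rewrite rootsP mem_nth ?sz_rs.
  exists u => //; apply/eqP; rewrite eqEsubv subvf -genL /=.
  apply/Fadjoin_seqP; split; first exact: sub1v.
  move=> x; rewrite -rootsP => /root_P1_exists_moebius[w Qw ->].
  apply: mem_moebius; apply: (mem_quarticQ_roots (memv_adjoin 1%AS u)).
  by rewrite -root_prod_XsubC -quarticQ_factor ?two_neq0_ext.
have galL : galois 1 {:L}.
  rewrite /galois sub1v normalFieldf andbT; apply/separableP=> x _.
  by apply: pcharf0_separable => p; rewrite (pchar_lalg L) pchar_num.
have dimL : \dim {:L} = 4%N.
  by rewrite -genu -(adjoin_degree_quarticQ Qu) adjoin_degreeE dimv1 divn1.
have cardG : #|'Gal({:L} / 1)%g| = 4%N by rewrite -galois_dim // dimv1 divn1.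
have [s Gs su] : exists2 s, s \in 'Gal({:L} / 1)%g & s u = quarticQ_conj u.
  apply: (normalField_root_minPoly (sub1v _) (normalFieldf _) (memvf _)).
  have Qu' : root (map_poly (in_alg L) (quarticQ rat)) u by rewrite map_quarticQ.
  rewrite (eqp_root (minPoly_irreducible irreducible_quarticQ Qu')) map_quarticQ.
  exact: root_quarticQ_conj.
have s2u : (s ^+ 2)%g u = - u.
  have sE : s (quarticQ_conj u) = quarticQ_conj (s u).
    by rewrite /quarticQ_conj rmorphB rmorphXn rmorphM rmorph_nat.
  rewrite expgS expg1 galM ?memvf // su sE su.
  exact: quarticQ_conjK.
(* The order divides 4 but not 2, because s^2 moves [u] to -u, which differs from [u]. *)
have order_s : #[s]%g = 4%N.
  have : (#[s]%g %| 4)%N by rewrite -cardG order_dvdG.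
  have : ~~ (#[s]%g %| 2)%N.
    rewrite order_dvdn; apply/eqP=> s21; move: s2u; rewrite s21 gal_id => /eqP.
    have := uniq_quarticQ_roots (two_neq0_ext L) Qu.
    by rewrite /= !inE => /and3P[/norP[_ /norP[/negPf->]]].
  by case: #[s]%g => [|[|[|[|[|n]]]]] // _ /dvdn_leq.
have defG : <[s]>%g = 'Gal({:L} / 1)%g.
  by apply/eqP; rewrite eqEcard cycle_subG Gs cardG -order_s /=.
have cycG : cyclic 'Gal({:L} / 1)%g by rewrite -defG cycle_cyclic.
rewrite isog_cyclic_card // cardG.
by rewrite card_Zp // /Zp_group /= /Zp /= Zp_cycle cycle_cyclic.
Qed.

(** For existence, the field generated by one root of the quartic already splits [P1], which also
    supplies the axiom needed to pack it as a [splittingFieldType]. *)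
Lemma galois_group_P1 : galois_group_isog P1 (Zp_group 4).
Proof.
split; last exact: gal_P1.
have [L [u [Qu genL]]] := exists_quarticQ_ext.
have splitL := splittingFieldFor_P1 Qu genL.
have ax : SplittingField.axiom L.
  by exists (map_poly (in_alg L) P1); first exact: alg_polyOver.
pose mixin := FieldExt_isSplittingField.Build rat L ax.
pose L' : splittingFieldType rat := HB.pack L mixin.
by exists L'.
Qed.

(** * Best approximation *)

Section RelErr.
Variable R : realType.
Implicit Types (g : {poly R}) (t : R).

Lemma sqrt_one_sqr_ge1 t : 1 <= Num.sqrt (1 + t ^+ 2).
Proof. by rewrite -[leLHS]sqrtr1 ler_wsqrtr // lerDl sqr_ge0. Qed.

Lemma horner_affine g t : (size g <= 2)%N -> g.[t] = g`_0 + g`_1 * t.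
Proof.
move=> szg; rewrite (horner_coef_wide _ szg) !big_ord_recl big_ord0 /=.
by rewrite mulr1 addr0.
Qed.

Lemma max_rel_err_ge g t : (size g <= 2)%N -> 0 <= t <= 1 ->
  `|g.[t] / Num.sqrt (1 + t ^+ 2) - 1| <= max_rel_err g.
Proof.
move=> szg t01; apply: ub_le_sup; last by exists t.
(* The supremum needs an upper bound; this one works because the square root is at least 1. *)
exists (`|g`_0| + `|g`_1| + 1) => _ [u /andP[u0 u1] <-].
rewrite (le_trans (ler_normB _ _)) // normr1 lerD2r (horner_affine _ szg).
have w1 := sqrt_one_sqr_ge1 u.
rewrite normrM normfV ler_pdivrMr; last by rewrite normr_gt0 gt_eqF // (lt_le_trans ltr01).
rewrite (ger0_norm (sqrtr_ge0 _)) (le_trans _ (ler_peMr _ w1)) ?addr_ge0 //.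
rewrite (le_trans (ler_normD _ _)) // lerD2l normrM.
by rewrite ler_piMr // ger0_norm.
Qed.

Lemma max_rel_err_le g e :
  (forall t, 0 <= t <= 1 -> `|g.[t] / Num.sqrt (1 + t ^+ 2) - 1| <= e) ->
  max_rel_err g <= e.
Proof.
move=> le_e; apply: ge_sup; last by move=> _ [t t01 <-]; apply: le_e.
(* The set must be inhabited; t = 0 is the witness. *)
exists (`|g.[0] / Num.sqrt (1 + 0 ^+ 2) - 1|); exists 0 => //=.
by rewrite lexx ler01.
Qed.

End RelErr.

(** * The extremal affine function *)

Section BestAffine.
Variable R : realType.

Local Notation s := (Num.sqrt 2 : R).
Local Notation c := (cos (pi / 8) : R).

Lemma sqrt2_sqr : s ^+ 2 = 2. Proof. by rewrite sqr_sqrtr. Qed.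

Lemma sqrt2_itv : 1 < s < 2.
Proof. by have := sqrt2_sqr; have := sqrtr_ge0 (2 : R); nra. Qed.

Lemma cos_pi4 : cos (pi / 4) = s / 2.
Proof.
have pi0 := pi_gt0 R.
have c0 : 0 < cos (pi / 4 : R) by rewrite cos_gt0_pihalf //; lra.
have : cos (pi / 4 *+ 2 : R) = 0.
  by rewrite -cos_pihalf; congr cos; rewrite -mulr_natr; field.
rewrite cos_mulr2n => c4.
have := sqrt2_sqr; have := sqrtr_ge0 (2 : R); rewrite -mulr_natr in c4; nra.
Qed.

Lemma cos_pi8_sqr : c ^+ 2 = (2 + s) / 4.
Proof.
have : cos (pi / 8 *+ 2 : R) = s / 2.
  by rewrite -cos_pi4; congr cos; rewrite -mulr_natr; field.
rewrite cos_mulr2n -mulr_natr; lra.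
Qed.

Lemma cos_pi8_gt0 : 0 < c.
Proof. by have pi0 := pi_gt0 R; rewrite cos_gt0_pihalf //; lra. Qed.

(** This is 1 + tan^2 = 1 / cos^2 at pi/8, where tan(pi/8) = s - 1. *)
Lemma inv_cos_pi8_sqr : (c ^+ 2)^-1 = 4 - 2 * s.
Proof.
have /andP[s1 _] := sqrt2_itv.
rewrite cos_pi8_sqr; apply: (@mulfI _ ((2 + s) / 4)); first by apply/eqP; lra.
rewrite mulfV; last by apply/eqP; lra.
rewrite (_ : _ * _ = 2 - s ^+ 2 / 2); last by field.
by rewrite sqrt2_sqr; field.
Qed.

Lemma inv_cos_pi8 : Num.sqrt (4 - 2 * s) = c^-1.
Proof.
have c0 := cos_pi8_gt0.
by rewrite -inv_cos_pi8_sqr -exprVn sqrtr_sqr ger0_norm // invr_ge0; lra.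
Qed.

Definition best_alpha : R := 2 * c / (1 + c).
(** The slope ratio tan(pi/8) = s - 1 puts the crest of the sinusoid at pi/8. *)
Definition best_beta : R := best_alpha * (s - 1).
Definition best_affine : {poly R} := best_alpha%:P + best_beta *: 'X.

Local Notation err := ((1 - c) / (1 + c)).

(** [best_alpha] is the relative value at t = 0 and t = 1, and [best_alpha / c] the one at the crest
    t = s - 1; the two lie symmetrically about 1. *)
Lemma best_alpha_err : best_alpha = 1 - err.
Proof. by have c0 := cos_pi8_gt0; rewrite /best_alpha; field; lra. Qed.

Lemma best_alpha_div_cos : best_alpha / c = 1 + err.
Proof. by have c0 := cos_pi8_gt0; rewrite /best_alpha; field; lra. Qed.

Lemma best_alpha_gt0 : 0 < best_alpha.
Proof. by have c0 := cos_pi8_gt0; rewrite divr_gt0; lra. Qed.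

Lemma size_best_affine : (size best_affine <= 2)%N.
Proof.
rewrite (leq_trans (size_polyD _ _)) // geq_max.
rewrite (leq_trans (size_polyC_leq1 _)) //=.
by rewrite (leq_trans (size_scale_leq _ _)) // size_polyX.
Qed.

Lemma horner_best_affine t :
  best_affine.[t] = best_alpha * (1 + (s - 1) * t).
Proof. by rewrite /best_affine !hornerE /best_beta; ring. Qed.

Lemma max_rel_err_best_affine_le : max_rel_err best_affine <= err.
Proof.
apply: max_rel_err_le => t /andP[t0 t1]; rewrite horner_best_affine.
have w1 := sqrt_one_sqr_ge1 t.
have w2 : Num.sqrt (1 + t ^+ 2) ^+ 2 = 1 + t ^+ 2.
  by rewrite sqr_sqrtr // addr_ge0 ?sqr_ge0.
set w := Num.sqrt (1 + t ^+ 2) in w1 w2 *.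
have w0 : 0 < w by lra.
have a0 := best_alpha_gt0.
have c0 := cos_pi8_gt0.
have /andP[s1 s2] := sqrt2_itv.
have s22 := sqrt2_sqr.
have kt0 : 0 <= 1 + (s - 1) * t by rewrite addr_ge0 // mulr_ge0 //; lra.
rewrite ler_distl -best_alpha_err -best_alpha_div_cos -mulrA.
rewrite ler_peMr ?(ltW a0) //= ?ler_pM2l //.
  rewrite ler_pdivrMr // -ler_sqr ?nnegrE // ?mulr_ge0 ?invr_ge0 //; try lra.
  rewrite exprMn exprVn inv_cos_pi8_sqr w2 -subr_ge0.
  (* Upper bound: Cauchy-Schwarz for (1, s - 1) and (1, t), with its defect written out modulo s^2 =
     2. *)
  rewrite (_ : _ - _ = (s - 1 - t) ^+ 2 + (1 + t ^+ 2) * (2 - s ^+ 2)); last by ring.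
  by rewrite s22 subrr mulr0 addr0 sqr_ge0.
rewrite ler_pdivlMr // mul1r -ler_sqr ?nnegrE // ?(ltW w0) // w2 -subr_ge0.
(* Lower bound: modulo s^2 = 2 the defect vanishes exactly at the endpoints 0 and 1. *)
rewrite (_ : _ - _ = 2 * (s - 1) * (t * (1 - t)) - t ^+ 2 * (2 - s ^+ 2)); last by ring.
by rewrite s22 subrr mulr0 subr0 !mulr_ge0 //; lra.
Qed.

(** The crest s - 1 is the barycentre of 0 and 1 with positive weights 2 - s and s - 1, so the lower
    bounds at the ends meet the upper bound at the crest. *)
Lemma best_affine_unique (g : {poly R}) :
  (size g <= 2)%N -> max_rel_err g <= err -> g = best_affine.
Proof.
move=> szg le_err.
have c0 := cos_pi8_gt0.
have /andP[s1 s2] := sqrt2_itv.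
have s22 := sqrt2_sqr.
have bound t : 0 <= t <= 1 ->
    best_alpha <= (g`_0 + g`_1 * t) / Num.sqrt (1 + t ^+ 2) <= best_alpha / c.
  move=> t01; rewrite best_alpha_div_cos best_alpha_err -ler_distl -horner_affine //.
  exact: le_trans (max_rel_err_ge szg t01) le_err.
have /andP[A _] : best_alpha <= g`_0 <= best_alpha / c.
  by have := bound 0; rewrite lexx ler01 expr0n mulr0 !addr0 sqrtr1 divr1; apply.
have B : best_alpha * s <= g`_0 + g`_1.
  have /andP[] : best_alpha <= (g`_0 + g`_1) / s <= best_alpha / c.
    by have := bound 1; rewrite lexx ler01 expr1n mulr1; apply.
  by rewrite ler_pdivlMr //; lra.
have M : g`_0 + g`_1 * (s - 1) <= best_alpha * (4 - 2 * s).
  have t01 : 0 <= s - 1 <= 1 by apply/andP; split; lra.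
  have /andP[_] := bound _ t01.
  rewrite (_ : 1 + (s - 1) ^+ 2 = 4 - 2 * s); last by rewrite sqrrB s22 expr1n; ring.
  rewrite inv_cos_pi8 invrK ler_pdivlMr // -mulrA -expr2.
  by rewrite -ler_pdivlMr ?exprn_gt0 // inv_cos_pi8_sqr.
(* The first two bounds force equality in the third. *)
have sum_le0 : (2 - s) * (g`_0 - best_alpha) +
    (s - 1) * (g`_0 + g`_1 - best_alpha * s) <= 0.
  rewrite [leLHS](_ : _ = g`_0 + g`_1 * (s - 1) - best_alpha * (4 - 2 * s)
      + best_alpha * (2 - s ^+ 2)); last by ring.
  by rewrite s22 subrr mulr0 addr0 subr_le0.
have g0 : g`_0 = best_alpha by nra.
have g1 : g`_1 = best_beta by rewrite /best_beta; nra.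
apply/polyP=> i; rewrite /best_affine !coefE.
case: i => [|[|i]] /=; rewrite ?mulr0 ?mulr1 ?addr0 ?add0r //.
by rewrite nth_default // (leq_trans szg).
Qed.

(** A strictly smaller error would force [g] to be [best_affine], whose error at t = 0 is already
    [err]. *)
Lemma le_err_max_rel_err (g : {poly R}) :
  (size g <= 2)%N -> err <= max_rel_err g.
Proof.
move=> szg; rewrite leNgt; apply/negP=> lt_err.
have := lt_err; rewrite (best_affine_unique szg (ltW lt_err)) ltNge => /negP[].
have t01 : 0 <= (0 : R) <= 1 by rewrite lexx ler01.
apply: le_trans (max_rel_err_ge size_best_affine t01).
rewrite horner_best_affine mulr0 addr0 mulr1 expr0n addr0 sqrtr1 divr1.
by rewrite best_alpha_err addrAC subrr add0r normrN ler_norm.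
Qed.

Lemma unique_best_affine : unique (@is_best_affine R) best_affine.
Proof.
split=> [|g [szg best_g]].
  split=> [|g szg]; first exact: size_best_affine.
  exact: le_trans max_rel_err_best_affine_le (le_err_max_rel_err szg).
apply/esym/best_affine_unique => //.
exact: le_trans (best_g _ size_best_affine) max_rel_err_best_affine_le.
Qed.

Lemma root_P1_best_alpha : root (map_poly ratr P1) best_alpha.
Proof.
have c0 := cos_pi8_gt0.
have -> : best_alpha = moebius (2 * c).
  by rewrite /best_alpha /moebius; field; apply/andP; split; lra.
apply/rootP; rewrite horner_P1 horner_P1_moebius; last by lra.
rewrite horner_quarticQ.
rewrite (_ : _ + 2 = 16 * (c ^+ 2) ^+ 2 - 16 * c ^+ 2 + 2); last by ring.
rewrite cos_pi8_sqr.
rewrite (_ : _ + 2 = s ^+ 2 - 2); last by field.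
by rewrite sqrt2_sqr subrr mulr0 mul0r.
Qed.

Lemma best_alphaE : best_alpha = 2 / (1 + Num.sqrt (4 - 2 * s)).
Proof.
have c0 := cos_pi8_gt0.
by rewrite inv_cos_pi8 /best_alpha; field; apply/andP; split; lra.
Qed.

Lemma best_alpha_approx : `|best_alpha - 9604 / 10000| < 1 / 20000.
Proof.
have := sqrtr_ge0 (2 : R); have s22 := sqrt2_sqr => s0.
(* Consecutive continued fraction convergents of the square root of 2. *)
have /andP[s1 s2] : 41 / 29 < s < 99 / 70 by nra.
have c0 := cos_pi8_gt0; have c2 := cos_pi8_sqr.
(* Rationals just outside the square roots of 99/116 and 239/280, between which c^2 = (2 + s) / 4
   lies. *)
have /andP[c1 c3] : 97 / 105 < c < 437 / 473 by nra.
rewrite ltr_distl /best_alpha ltr_pdivlMr ?ltr_pdivrMr; lra.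
Qed.

End BestAffine.

Theorem proposition1 (R : realType) :
  exists alpha beta : R,
    unique (@is_best_affine R) (alpha%:P + beta *: 'X) /\
    root (map_poly ratr P1) alpha /\
    irreducible_poly P1 /\
    galois_group_isog P1 (Zp_group 4) /\
    discriminant P1 = 2 ^+ 29 /\
    alpha = 2 * cos (pi / 8) / (1 + cos (pi / 8)) /\
    alpha = 2 / (1 + Num.sqrt (4 - 2 * Num.sqrt 2)) /\
    `|alpha - 9604 / 10000| < 1 / 20000.
Proof.
exists (best_alpha R), (best_beta R); split; first exact: unique_best_affine.
split; first exact: root_P1_best_alpha.
split; first exact: irreducible_P1.
split; first exact: galois_group_P1.
split; first exact: discriminant_P1.
split; first by [].
split; first exact: best_alphaE.
exact: best_alpha_approx.
Qed.
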